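(* Let $(\mathfrak J,B)$ be a pseudo-Euclidean Jacobi-Jordan algebra over a field $\mathbb K$ of characteristic $0$. Then, with $\mathbb K$ regarded as the trivial $\mathfrak J$-module: (i) ${}_zH^2_s(\mathfrak J,\mathbb K)\simeq \mathrm{ADer}_s(\mathfrak J)/\mathrm{IADer}(\mathfrak J)$; (ii) ${}_zZ^2_a(\mathfrak J,\mathbb K)\simeq \mathrm{Der}_a(\mathfrak J)$.
   Context: A Jacobi-Jordan algebra is a vector space $\mathfrak J$ with a bilinear product $(x,y)\mapsto xy$ such that $xy=yx$ and $x(yz)+y(zx)+z(xy)=0$ for all $x,y,z$. It is pseudo-Euclidean if it is endowed with a nondegenerate symmetric bilinear form $B$ that is associative: $B(xy,z)=B(x,yz)$ for all $x,y,z$. Cohomology with values in the trivial module $\mathbb K$: ${}_zZ^2(\mathfrak J,\mathbb K)$ is the space of bilinear forms $c$ on $\mathfrak J$ with $c(xy,z)+c(xz,y)+c(yz,x)=0$ for all $x,y,z$; ${}_zZ^2_s(\mathfrak J,\mathbb K)$ and ${}_zZ^2_a(\mathfrak J,\mathbb K)$ are its subspaces of symmetric, respectively skew-symmetric, forms; ${}_zB^2(\mathfrak J,\mathbb K)=\{(x,y)\mapsto -f(xy): f:\mathfrak J\to\mathbb K \text{ linear}\}$; ${}_zH^2_s(\mathfrak J,\mathbb K)={}_zZ^2_s(\mathfrak J,\mathbb K)/{}_zB^2(\mathfrak J,\mathbb K)$. A derivation is a linear map $D:\mathfrak J\to\mathfrak J$ with $D(xy)=D(x)y+xD(y)$; an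 anti-derivation is a linear map $D$ with $D(xy)=-D(x)y-xD(y)$. A (anti-)derivation $D$ is symmetric (resp. skew-symmetric) with respect to $B$ if $B(D(x),y)=B(x,D(y))$ (resp. $B(D(x),y)=-B(x,D(y))$) for all $x,y$. $\mathrm{ADer}_s(\mathfrak J)$ is the space of $B$-symmetric anti-derivations, $\mathrm{Der}_a(\mathfrak J)$ the space of $B$-skew-symmetric derivations, and $\mathrm{IADer}(\mathfrak J)=\{L_x: x\in\mathfrak J\}$ with $L_x(y)=xy$.
   Formalization: The algebra is assumed finite-dimensional; for infinite-dimensional algebras the claim can fail (e.g. real ℓ² with zero product and its inner product, where the skew-symmetric cocycles form a space of strictly larger dimension than the skew-symmetric derivations). *)

(* Defs.v *)
From HB Require Import structures.
From mathcomp Require Import all_boot all_order all_algebra.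
From mathcomp Require Import boolp.

Set Implicit Arguments.
Unset Strict Implicit.
Unset Printing Implicit Defensive.

Import GRing.Theory.
Local Open Scope ring_scope.
Local Open Scope quotient_scope.

Section QuotientModule.
Variables (K : nzRingType) (V : lmodType K).

Inductive submodule (A : submodClosed V) : Type :=
  Submodule (v : V) of v \in A.

Definition submodule_val (A : submodClosed V) (x : submodule A) : V :=
  let: Submodule v _ := x in v.

HB.instance Definition _ (A : submodClosed V) :=
  [isSub for @submodule_val A].
HB.instance Definition _ (A : submodClosed V) :=
  [Choice of submodule A by <:].
HB.instance Definition _ (A : submodClosed V) :=
  [SubChoice_isSubLmodule of submodule A by <:].

Variables A B : submodClosed V.

Definition relative : {pred submodule A} := fun x => submodule_val x \in B.

Let valB (x y : submodule A) :
  submodule_val (x - y) = submodule_val x - submodule_val y.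
Proof. exact: (raddfB (val : submodule A -> V)). Qed.

Lemma relative_zmod_closed : zmod_closed relative.
Proof.
have [B0 Blin] := GRing.submodClosedP B.
split=> [|x y]; rewrite !unfold_in /relative.
  by have -> : submodule_val (0 : submodule A) = 0 by [].
by move=> xB yB; rewrite valB addrC -scaleN1r; apply: Blin.
Qed.
HB.instance Definition _ :=
  GRing.isZmodClosed.Build _ relative relative_zmod_closed.

(* The quotient A / (A :&: B), i.e. A / B as soon as B is contained in A. *)
Definition quotient_module : Type := Quotient.quot relative.
HB.instance Definition _ := GRing.Zmodule.on quotient_module.
HB.instance Definition _ := EqQuotient.on quotient_module.

Let pi (x : submodule A) : quotient_module := \pi_(Quotient.quot relative) x.
Let scaleq (a : K) (u : quotient_module) : quotient_module :=
  pi (a *: (repr u : submodule A)).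

Let piD x y : pi (x + y) = pi x + pi y.
Proof. by rewrite /pi !piE. Qed.

Let piZ a x : scaleq a (pi x) = pi (a *: x).
Proof.
rewrite /scaleq /pi; apply/eqP; rewrite -Quotient.idealrBE -scalerBr.
have : repr (pi x) - x \in relative.
  by rewrite Quotient.idealrBE reprK.
rewrite !unfold_in /relative => h.
have -> : submodule_val (a *: (repr (pi x) - x)) =
          a *: submodule_val (repr (pi x) - x).
  exact: GRing.valZ.
exact: rpredZ.
Qed.

Let pi_surj (u : quotient_module) : exists x, u = pi x.
Proof. by exists (repr u); rewrite /pi reprK. Qed.

Let scaleqA a b u : scaleq a (scaleq b u) = scaleq (a * b) u.
Proof. by case: (pi_surj u) => x ->; rewrite !piZ scalerA. Qed.
Let scaleq1 : left_id 1 scaleq.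
Proof. by move=> u; case: (pi_surj u) => x ->; rewrite piZ scale1r. Qed.
Let scaleqDr : right_distributive scaleq +%R.
Proof.
move=> a u v; case: (pi_surj u) => x ->; case: (pi_surj v) => y ->.
by rewrite -piD !piZ scalerDr piD.
Qed.
Let scaleqDl u : {morph scaleq^~ u : a b / a + b}.
Proof. by move=> a b; case: (pi_surj u) => x ->; rewrite !piZ scalerDl piD. Qed.

HB.instance Definition _ := GRing.Zmodule_isLmodule.Build K quotient_module
  scaleqA scaleq1 scaleqDr scaleqDl.

Definition quotient_proj (x : submodule A) : quotient_module :=
  \pi_(Quotient.quot relative) x.

Lemma quotient_proj_is_linear : linear quotient_proj.
Proof. by move=> a x y; rewrite [LHS]piD -[pi (a *: x)]piZ. Qed.
HB.instance Definition _ := GRing.isLinear.Build K _ _ _ quotient_proj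
  quotient_proj_is_linear.

Lemma quotient_projP (u : quotient_module) : exists x, quotient_proj x = u.
Proof. by case: (pi_surj u) => x ->; exists x. Qed.

Lemma quotient_proj_eq x y :
  quotient_proj x = quotient_proj y <-> submodule_val x - submodule_val y \in B.
Proof.
have -> : (submodule_val x - submodule_val y \in B) = (x - y \in relative).
  by rewrite -valB.
rewrite Quotient.idealrBE; split=> [h|/eqP//].
by apply/eqP.
Qed.

End QuotientModule.

Definition linear_iso (K : nzRingType) (U V : lmodType K) : Prop :=
  exists f : {linear U -> V}, bijective f.

Section JacobiJordan.
Variables (K : fieldType) (J : vectType K) (mul : {bilinear J -> J -> J}).

Definition jacobi_jordan : Prop :=
  (forall x y, mul x y = mul y x) /\
  (forall x y z,
     mul x (mul y z) + mul y (mul z x) + mul z (mul x y) = 0).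

Definition pseudo_euclidean (B : {symmetric J}) : Prop :=
  nondegenerate B /\ (forall x y z, B (mul x y) z = B x (mul y z)).

(* Bilinear forms in curried form; [c x y] is the value of [c] at [(x, y)]. *)
Definition bilform := 'Hom(J, 'Hom(J, K^o)).
HB.instance Definition _ := Vector.on bilform.

Definition cocycle (c : bilform) : Prop :=
  forall x y z, c (mul x y) z + c (mul x z) y + c (mul y z) x = 0.

Definition Z2s : {pred bilform} :=
  fun c => `[< cocycle c /\ forall x y, c x y = c y x >].

Definition Z2a : {pred bilform} :=
  fun c => `[< cocycle c /\ forall x y, c x y = - c y x >].

Definition B2 : {pred bilform} :=
  fun c => `[< exists f : 'Hom(J, K^o), forall x y, c x y = - f (mul x y) >].

Definition derivation (D : 'End(J)) : Prop :=
  forall x y, D (mul x y) = mul (D x) y + mul x (D y).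

Definition antiderivation (D : 'End(J)) : Prop :=
  forall x y, D (mul x y) = - mul (D x) y - mul x (D y).

Definition Der_a (B : {symmetric J}) : {pred 'End(J)} :=
  fun D => `[< derivation D /\ forall x y, B (D x) y = - B x (D y) >].

Definition ADer_s (B : {symmetric J}) : {pred 'End(J)} :=
  fun D => `[< antiderivation D /\ forall x y, B (D x) y = B x (D y) >].

Definition IADer : {pred 'End(J)} :=
  fun D => `[< exists x, forall y, D y = mul x y >].

Let lfE := (add_lfunE, scale_lfunE, zero_lfunE).

Let cocycle_lin a c d : cocycle c -> cocycle d -> cocycle (a *: c + d).
Proof.
move=> hc hd x y z; rewrite !lfE.
rewrite [X in X + _]addrACA -scalerDr addrACA -scalerDr hc hd.
by rewrite scaler0 addr0.
Qed.

Let cocycle0 : cocycle 0.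
Proof. by move=> x y z; rewrite !lfE !addr0. Qed.

Lemma Z2s_closed : submod_closed Z2s.
Proof.
split=> [|a c d /asboolP[hc sc] /asboolP[hd sd]]; apply/asboolP.
  by split=> // x y; rewrite !lfE.
by split=> [|x y]; [exact: cocycle_lin | rewrite !lfE sc sd].
Qed.
HB.instance Definition _ := GRing.isSubmodClosed.Build K bilform Z2s
  (GRing.submod_closed_semi Z2s_closed).

Lemma Z2a_closed : submod_closed Z2a.
Proof.
split=> [|a c d /asboolP[hc sc] /asboolP[hd sd]]; apply/asboolP.
  by split=> // x y; rewrite !lfE oppr0.
by split=> [|x y]; [exact: cocycle_lin | rewrite !lfE sc sd scalerN opprD].
Qed.
HB.instance Definition _ := GRing.isSubmodClosed.Build K bilform Z2a
  (GRing.submod_closed_semi Z2a_closed).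

Lemma B2_closed : submod_closed B2.
Proof.
split=> [|a c d /asboolP[f hf] /asboolP[g hg]]; apply/asboolP.
  by exists 0 => x y; rewrite !lfE oppr0.
by exists (a *: f + g) => x y; rewrite !lfE hf hg scalerN opprD.
Qed.
HB.instance Definition _ := GRing.isSubmodClosed.Build K bilform B2
  (GRing.submod_closed_semi B2_closed).

Let mulDl a x x' y : mul (a *: x + x') y = a *: mul x y + mul x' y.
Proof. by rewrite linearPl. Qed.
Let mulDr a x y y' : mul x (a *: y + y') = a *: mul x y + mul x y'.
Proof. by rewrite linearPr. Qed.

Let formDl (B : {symmetric J}) a x x' y :
  B (a *: x + x') y = a * B x y + B x' y.
Proof. exact: linearPl. Qed.
Let formDr (B : {symmetric J}) a x y y' :
  B x (a *: y + y') = a * B x y + B x y'.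
Proof. exact: linearPr. Qed.

Lemma Der_a_closed B : submod_closed (Der_a B).
Proof.
split=> [|a c d /asboolP[hc sc] /asboolP[hd sd]]; apply/asboolP.
  by split=> x y; rewrite !lfE !(linear0l, linear0r) ?addr0 ?oppr0.
split=> x y; rewrite !lfE.
  by rewrite mulDl mulDr hc hd scalerDr addrACA.
by rewrite formDl formDr sc sd mulrN opprD.
Qed.
HB.instance Definition _ B := GRing.isSubmodClosed.Build K 'End(J) (Der_a B)
  (GRing.submod_closed_semi (Der_a_closed B)).

Lemma ADer_s_closed B : submod_closed (ADer_s B).
Proof.
split=> [|a c d /asboolP[hc sc] /asboolP[hd sd]]; apply/asboolP.
  by split=> x y; rewrite !lfE !(linear0l, linear0r) ?subr0 ?oppr0.
split=> x y; rewrite !lfE.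
  by rewrite mulDl mulDr hc hd !opprD scalerDr !scalerN addrACA.
by rewrite formDl formDr sc sd.
Qed.
HB.instance Definition _ B := GRing.isSubmodClosed.Build K 'End(J) (ADer_s B)
  (GRing.submod_closed_semi (ADer_s_closed B)).

Lemma IADer_closed : submod_closed IADer.
Proof.
split=> [|a c d /asboolP[x hx] /asboolP[y hy]]; apply/asboolP.
  by exists 0 => y; rewrite !lfE linear0l.
by exists (a *: x + y) => z; rewrite !lfE mulDl hx hy.
Qed.
HB.instance Definition _ := GRing.isSubmodClosed.Build K 'End(J) IADer
  (GRing.submod_closed_semi IADer_closed).

Lemma B2_sub_Z2s : jacobi_jordan -> {subset B2 <= Z2s}.
Proof.
move=> [mulC jac] c /asboolP[f hf]; apply/asboolP; split=> [x y z|x y].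
  have e : mul (mul x y) z + mul (mul x z) y + mul (mul y z) x = 0.
    rewrite -(jac x y z) (mulC (mul x y)) (mulC (mul x z)) (mulC (mul y z)).
    by rewrite (mulC x z) addrC [X in _ + X]addrC addrA.
  have fD u v : f (u + v) = f u + f v by exact: raddfD.
  have f0 : f 0 = 0 by exact: raddf0.
  by rewrite !hf -(oppr0 K) -[in RHS]f0 -e !fD !opprD.
by rewrite !hf mulC.
Qed.

Lemma IADer_sub_ADer_s B :
  jacobi_jordan -> pseudo_euclidean B -> {subset IADer <= ADer_s B}.
Proof.
move=> [mulC jac] [_ ass] D /asboolP[x hx]; apply/asboolP.
split=> [y z|y z]; rewrite !hx.
  have := jac x y z; rewrite (mulC z x) (mulC z (mul x y)) => /eqP.
  by rewrite -addrA addr_eq0 opprD addrC => /eqP ->; rewrite addrC.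
by rewrite mulC ass.
Qed.

Definition H2s := quotient_module Z2s B2.

End JacobiJordan.

(* Main.v *)
Require Import Defs.
From mathcomp Require Import all_boot all_order all_algebra.
From HB Require Import structures.
From mathcomp Require Import boolp.
Local Open Scope ring_scope.

Set Implicit Arguments.
Unset Strict Implicit.
Unset Printing Implicit Defensive.
Import GRing.Theory.

(** A nondegenerate symmetric form [B] on a finite-dimensional space [J]
    identifies [J] with its dual by [x |-> B x], hence bilinear forms with
    endomorphisms: [D] corresponds to [c(x, y) = B(D x, y)].  Both isomorphisms
    of the theorem are restrictions of this single linear bijection.

    Suppose that [D] is self-adjoint up to a scalar [s], that is,
    [B(D x, y) = s B(x, D y)]; this says that [c] is symmetric for [s = 1] and
    skew-symmetric for [s = -1].  Moving [D] and the products across [B], by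
    associativity and commutativity, turns the cocycle sum into
    [[
      c(xy, z) + c(xz, y) + c(yz, x) = B(D(xy) + s (D(x)y + xD(y)), z),
    ]]
    so by nondegeneracy [c] is a cocycle iff [D(xy) = - s (D(x)y + xD(y))]
    ([cocycle_form_of_operator]): an anti-derivation for [s = 1], a derivation
    for [s = -1].

    Every linear form is [B a] for some [a], and the coboundary of [- B a] is
    [(x, y) |-> B(a, xy) = B(ax, y)], which is the form of the multiplication
    operator [L_a].  Coboundaries therefore correspond exactly to [IADer]
    ([form_of_operator_B2]), and the bijection passes to the quotients. *)

Section Transport.
Variables (K : nzRingType) (U V : lmodType K) (T : {linear U -> V}).
Variables (A : submodClosed U) (A' : submodClosed V).
Hypothesis TA : forall u, u \in A -> T u \in A'.

Definition submodule_map (x : submodule A) : submodule A' :=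
  Submodule (TA (valP x)).

Lemma submodule_map_is_linear : linear submodule_map.
Proof.
move=> a x y; apply: val_inj; rewrite [RHS]linearP /=.
by rewrite -linearP; congr (T _); apply: (linearP (val : submodule A -> U)).
Qed.
HB.instance Definition _ := GRing.isLinear.Build K _ _ _ submodule_map
  submodule_map_is_linear.

Variables (C : submodClosed U) (C' : submodClosed V).
Hypothesis TC : forall u, u \in C -> T u \in C'.

(** The class is sent to the image of a representative picked by choice;
    [quotient_mapE] shows that any representative gives the same result. *)
Definition quotient_map (q : quotient_module A C) : quotient_module A' C' :=
  quotient_proj C' (submodule_map (sval (cid (quotient_projP q)))).

Lemma quotient_mapE x :
  quotient_map (quotient_proj C x) = quotient_proj C' (submodule_map x).
Proof.
rewrite /quotient_map; case: cid => y /= /quotient_proj_eq yx.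
by apply/quotient_proj_eq; rewrite /= -linearB; apply: TC.
Qed.

Lemma quotient_map_is_linear : linear quotient_map.
Proof.
move=> a p q; have [x <-] := quotient_projP p; have [y <-] := quotient_projP q.
by rewrite -linearP !quotient_mapE -!linearP.
Qed.

End Transport.

Section TransportIso.
Variables (K : nzRingType) (U V : lmodType K).
Variables (T : {linear U -> V}) (S : {linear V -> U}).
Hypotheses (TK : cancel T S) (SK : cancel S T).
Variables (A : submodClosed U) (A' : submodClosed V).
Hypothesis SA : forall v, (S v \in A) = (v \in A').

Let TA u : u \in A -> T u \in A'.
Proof. by rewrite -SA TK. Qed.
Let SA' v : v \in A' -> S v \in A.
Proof. by rewrite SA. Qed.

(** The hypotheses are equalities of membership tests, on the inverse map only,
    because the two bijections are used in the direction in which membership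
    is easiest to compute; [TK] gives the other direction. *)
Lemma linear_iso_submodule : linear_iso (submodule A) (submodule A').
Proof.
exists (submodule_map TA); exists (submodule_map SA') => x; apply: val_inj => /=.
  exact: TK.
exact: SK.
Qed.

Variables (C : submodClosed U) (C' : submodClosed V).
Hypothesis SC : forall v, (S v \in C) = (v \in C').

Let TC u : u \in C -> T u \in C'.
Proof. by rewrite -SC TK. Qed.
Let SC' v : v \in C' -> S v \in C.
Proof. by rewrite SC. Qed.

Lemma linear_iso_quotient :
  linear_iso (quotient_module A C) (quotient_module A' C').
Proof.
pose linT := GRing.isLinear.Build K _ _ _ _ (quotient_map_is_linear TA TC).
pose f : {linear _ -> _} := HB.pack (quotient_map (C := C) TA C') linT.
exists f; exists (quotient_map (C := C') SA' C) => q;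
  have [x <-] := quotient_projP q.
  rewrite /= !quotient_mapE //; congr quotient_proj; apply: val_inj; exact: TK.
rewrite /= !quotient_mapE //; congr quotient_proj; apply: val_inj; exact: SK.
Qed.

End TransportIso.

Section Duality.
Variables (K : fieldType) (J : vectType K) (B : {symmetric J}).

Lemma formC x y : B x y = B y x.
Proof. by rewrite hermC expr0 mul1r. Qed.

(** [flat_at x] and [flat] are the musical morphism [x |-> B x] from [J] to its
    dual. *)
Definition flat_at (x : J) : 'Hom(J, K^o) := linfun (B x : J -> K^o).

Lemma flat_atE x y : flat_at x y = B x y.
Proof. by rewrite lfunE. Qed.

Lemma flat_at_is_linear : linear flat_at.
Proof.
move=> a x y; apply/lfunP => z.
by rewrite add_lfunE scale_lfunE !flat_atE; apply: linearPl.
Qed.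
HB.instance Definition _ := GRing.isLinear.Build K _ _ _ flat_at
  flat_at_is_linear.

Definition flat : bilform J := linfun flat_at.

Lemma flatE x y : flat x y = B x y.
Proof. by rewrite lfunE flat_atE. Qed.

Hypothesis Bnd : nondegenerate B.

Lemma nondegenerate_inj x x' : (forall y, B x y = B x' y) -> x = x'.
Proof.
move=> xx'; apply/eqP; rewrite -subr_eq0 -memv0 -(eqP Bnd).
by apply/mem_orthovP => y _; rewrite linearBl /= xx' subrr.
Qed.

Lemma lker_flat : lker flat == 0%VS.
Proof.
apply/lker0P => x x' xx'; apply: nondegenerate_inj => y.
by rewrite -!flatE xx'.
Qed.

(** This is where finite dimension enters: an injective map between spaces of
    the same dimension is onto, so every linear form on [J] is some [B a]. *)
Lemma limg_flat : limg flat = fullv.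
Proof.
apply/eqP; rewrite eqEdim subvf limg_dim_eq ?(eqP lker_flat) ?capv0 //.
by rewrite !dimvf /dim /= muln1.
Qed.

Definition operator_of_form (c : bilform J) : 'End(J) := (flat^-1 \o c)%VF.
Definition form_of_operator (D : 'End(J)) : bilform J := (flat \o D)%VF.

Lemma operator_of_form_is_linear : linear operator_of_form.
Proof. by move=> a c d; rewrite /operator_of_form comp_lfunDr comp_lfunZr. Qed.
HB.instance Definition _ := GRing.isLinear.Build K _ _ _ operator_of_form
  operator_of_form_is_linear.

Lemma form_of_operator_is_linear : linear form_of_operator.
Proof. by move=> a c d; rewrite /form_of_operator comp_lfunDr comp_lfunZr. Qed.
HB.instance Definition _ := GRing.isLinear.Build K _ _ _ form_of_operator
  form_of_operator_is_linear.

Lemma form_of_operatorE D x y : form_of_operator D x y = B (D x) y.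
Proof. by rewrite comp_lfunE flatE. Qed.

Lemma operator_of_formK : cancel operator_of_form form_of_operator.
Proof.
move=> c; apply/lfunP => x.
by rewrite !comp_lfunE limg_lfunVK // limg_flat memvf.
Qed.

Lemma form_of_operatorK : cancel form_of_operator operator_of_form.
Proof.
by move=> D; apply/lfunP => x; rewrite !comp_lfunE lker0_lfunK ?lker_flat.
Qed.

Variable mul : {bilinear J -> J -> J}.
Hypothesis mulC : forall x y, mul x y = mul y x.
Hypothesis mulB : forall x y z, B (mul x y) z = B x (mul y z).

(** The scalar [s] treats both cases at once: [s = 1] for symmetric cocycles and
    anti-derivations, [s = -1] for skew-symmetric cocycles and derivations. *)
Lemma cocycle_form_of_operator (D : 'End(J)) (s : K) :
  (forall x y, B (D x) y = s * B x (D y)) ->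
  cocycle mul (form_of_operator D) <->
  forall x y, D (mul x y) = - s *: (mul (D x) y + mul x (D y)).
Proof.
move=> sD.
have adj x y z : form_of_operator D (mul x z) y = B (s *: mul x (D y)) z.
  rewrite form_of_operatorE sD linearZl /= [mul x z]mulC mulB.
  by rewrite [in RHS]formC.
have sum x y z : form_of_operator D (mul x y) z
    + form_of_operator D (mul x z) y + form_of_operator D (mul y z) x
    = B (D (mul x y) + s *: (mul (D x) y + mul x (D y))) z.
  rewrite (adj x y z) (adj y x z) form_of_operatorE scalerDr !linearDl /=.
  by rewrite [mul y _]mulC addrAC !addrA.
split=> [cD x y|Dmul x y z].
  apply/eqP; rewrite scaleNr -addr_eq0; apply/eqP.
  by apply: nondegenerate_inj => z; rewrite -sum cD linear0l.
by rewrite sum Dmul scaleNr addNr linear0l.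
Qed.

Lemma form_of_operator_Z2s D :
  (form_of_operator D \in Z2s mul) = (D \in ADer_s mul B).
Proof.
apply/asboolP/asboolP => -[hD sD].
  have sD' x y : B (D x) y = B x (D y).
    by rewrite -form_of_operatorE sD form_of_operatorE formC.
  split=> // x y; rewrite (cocycle_form_of_operator (s := 1) _).1 //.
    by rewrite scaleN1r opprD.
  by move=> u v; rewrite mul1r.
split=> [|x y]; last by rewrite !form_of_operatorE sD formC.
apply/(cocycle_form_of_operator (s := 1)) => [u v|x y]; first by rewrite mul1r.
by rewrite hD scaleN1r opprD.
Qed.

Lemma form_of_operator_Z2a D :
  (form_of_operator D \in Z2a mul) = (D \in Der_a mul B).
Proof.
apply/asboolP/asboolP => -[hD sD].
  have sD' x y : B (D x) y = - B x (D y).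
    by rewrite -form_of_operatorE sD form_of_operatorE formC.
  split=> // x y; rewrite (cocycle_form_of_operator (s := -1) _).1 //.
    by rewrite opprK scale1r.
  by move=> u v; rewrite mulN1r.
split=> [|x y]; last by rewrite !form_of_operatorE sD formC.
apply/(cocycle_form_of_operator (s := -1)) => [u v|x y]; first by rewrite mulN1r.
by rewrite hD opprK scale1r.
Qed.

(** If [B(D x, y) = - f(xy)] and [f = B a], then associativity gives
    [B(D x, y) = B(- a x, y)], so [D] is multiplication by [- a]. *)
Lemma form_of_operator_B2 D :
  (form_of_operator D \in B2 mul) = (D \in IADer mul).
Proof.
apply/asboolP/asboolP => [[f Df]|[a Da]].
  exists (- (flat^-1)%VF f) => x; apply: nondegenerate_inj => y.
  rewrite -form_of_operatorE Df mulB linearNl /= -flatE limg_lfunVK //.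
  by rewrite limg_flat memvf.
exists (- flat a) => x y.
by rewrite form_of_operatorE opp_lfunE opprK flatE Da mulB.
Qed.

End Duality.

Theorem corollary3 (K : fieldType) (J : vectType K)
    (mul : {bilinear J -> J -> J}) (B : {symmetric J}) :
  [pchar K] =i pred0 ->
  jacobi_jordan mul ->
  pseudo_euclidean mul B ->
  linear_iso (H2s mul) (quotient_module (ADer_s mul B) (IADer mul)) /\
  linear_iso (submodule (Z2a mul)) (submodule (Der_a mul B)).
Proof.
move=> _ [mulC _] [Bnd mulB].
have TK := operator_of_formK Bnd; have SK := form_of_operatorK Bnd.
split.
  apply: (linear_iso_quotient TK SK) => D.
    exact: form_of_operator_Z2s.
  exact: form_of_operator_B2.
by apply: (linear_iso_submodule TK SK) => D; exact: form_of_operator_Z2a.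
Qed.
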